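(* Let $(X,\omega)$ be a (weak) symplectic Banach space and let $(X,X^+,X^-)$ be a symplectic splitting. Let $\lambda,\mu$ be isotropic subspaces, and let $U,V$ denote their generating operators, i.e. the injective operators with domains in $X^+$ and values in $X^-$ whose graphs are $\lambda$ and $\mu$ respectively. Assume that $V\colon X^+\to X^-$ is (everywhere defined,) bounded and bounded invertible. Then: (a) The space $\mu$ is a Lagrangian subspace of $X$. (b) $(\lambda,\mu)$ is a Fredholm pair of closed subspaces of $X$ if and only if $UV^{-1}-I_{X^-}$ is a Fredholm operator with domain $V(\mathrm{dom}\,U)$. (c) In this case, $U-V$ is a (closed, not necessarily bounded) Fredholm operator with domain $\mathrm{dom}\,U$, and $$\mathrm{index}(\lambda,\mu)=\mathrm{index}(UV^{-1}-I_{X^-}).$$ (d) In particular, $U-V$ (and thus $UV^{-1}-I_{X^-}$) is closed if $\lambda$ is closed and $V$ is bounded (as assumed above).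
   Context: A (weak) symplectic Banach space is a complex Banach space $X$ with a bounded map $\omega\colon X\times X\to\mathbb C$, linear in the first and conjugate linear in the second variable, with $\omega(y,x)=-\overline{\omega(x,y)}$, and non-degenerate ($\omega(x,y)=0$ for all $y$ implies $x=0$). For a subspace $\lambda$, $\lambda^\omega=\{y:\omega(x,y)=0\ \forall x\in\lambda\}$; $\lambda$ is isotropic if $\lambda\subset\lambda^\omega$ and Lagrangian if $\lambda=\lambda^\omega$. A symplectic splitting is a decomposition $X=X^+\oplus X^-$ into linear subspaces such that $-i\omega$ is positive definite on $X^+$ and negative definite on $X^-$, and $\omega(x,y)=0$ for $x\in X^+,y\in X^-$; then $X^\pm$ are closed. Each isotropic subspace is the graph $\{x+Ux:x\in\mathrm{dom}(U)\}$ of a unique injective linear operator $U\colon\mathrm{dom}(U)\to X^-$, $\mathrm{dom}(U)\subset X^+$. A pair $(\lambda,\mu)$ of subspaces is a Fredholm pair if $\lambda,\mu,\lambda+\mu$ are closed, $\dim\lambda\cap\mu<\infty$ and $\dim X/(\lambda+\mu)<\infty$; its index is $\dim\lambda\cap\mu-\dim X/(\lambda+\mu)$. A Fredholm operator here is a closed, not necessarily bounded (and not necessarily densely defined) operator with finite-dimensional kernel and closed range of finite codimension; its index is the difference of these dimensions. *)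

(* Defs.v *)
From HB Require Import structures.
From mathcomp Require Import all_boot all_order all_algebra.
From mathcomp Require Import all_classical all_reals all_analysis.
From mathcomp Require Import complex.

Set Implicit Arguments.
Unset Strict Implicit.
Unset Printing Implicit Defensive.

Import Order.TTheory GRing.Theory Num.Theory.
Import numFieldNormedType.Exports.

Local Open Scope classical_set_scope.
Local Open Scope ring_scope.
Local Open Scope complex_scope.

Section LinearSubspaces.
Context {R : realType} {X : completeNormedModType R[i]}.
Implicit Types A B : set X.

Definition is_subspace A : Prop := submod_closed [in A].

Definition subspace_sum A B : set X := [set x + y | x in A & y in B].

Definition has_dim A (n : nat) : Prop :=
  exists e : 'I_n -> X,
    [/\ forall i, A (e i),
        forall a : 'I_n -> R[i], \sum_i a i *: e i = 0 -> forall i, a i = 0 &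
        forall x, A x -> exists a : 'I_n -> R[i], x = \sum_i a i *: e i].

(* dim (A / B) = n, for B `<=` A: the classes of the e i form a basis of A / B. *)
Definition has_codim A B (n : nat) : Prop :=
  exists e : 'I_n -> X,
    [/\ forall i, A (e i),
        forall a : 'I_n -> R[i], B (\sum_i a i *: e i) -> forall i, a i = 0 &
        forall x, A x -> exists a : 'I_n -> R[i], B (x - \sum_i a i *: e i)].

Definition finite_dim A : Prop := exists n, has_dim A n.
Definition finite_codim A B : Prop := exists n, has_codim A B n.

(* Meaningful only in the finite-dimensional case; 0 otherwise. *)
Definition subspace_dim A : nat := xget 0%N [set n | has_dim A n].
Definition subspace_codim A B : nat := xget 0%N [set n | has_codim A B n].

Definition fredholm_pair (lambda mu : set X) : Prop :=
  [/\ closed lambda, closed mu, closed (subspace_sum lambda mu),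
      finite_dim (lambda `&` mu) &
      finite_codim [set: X] (subspace_sum lambda mu)].

Definition pair_index (lambda mu : set X) : int :=
  (subspace_dim (lambda `&` mu))%:Z - (subspace_codim [set: X] (subspace_sum lambda mu))%:Z.

End LinearSubspaces.

Section Operators.
Context {R : realType} {X : completeNormedModType R[i]}.
Implicit Types (E F : set X).

(* A not necessarily everywhere defined operator inside X. The values of opfun
   outside dom are irrelevant. *)
Record operator := Operator { dom : set X; opfun :> X -> X }.
Implicit Types S T : operator.

Definition ran T : set X := T @` dom T.
Definition ker T : set X := [set x | dom T x /\ T x = 0].
Definition op_graph T : set (X * X) := [set (x, T x) | x in dom T].

Definition op_id E : operator := Operator E id.
Definition op_sub S T : operator :=
  Operator (dom S `&` dom T) (fun x => S x - T x).
Definition op_comp S T : operator :=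
  Operator [set x | dom T x /\ dom S (T x)] (fun x => S (T x)).
Definition op_inv T : operator :=
  Operator (ran T) ('pinv_(fun=> 0) (dom T) T).

Definition op_injective T : Prop :=
  forall x y, dom T x -> dom T y -> T x = T y -> x = y.

Definition linear_operator E F T : Prop :=
  [/\ is_subspace (dom T), dom T `<=` E, ran T `<=` F &
      forall (a : R[i]) x y, dom T x -> dom T y -> T (a *: x + y) = a *: T x + T y].

Definition bounded_operator T : Prop :=
  exists M : R, forall x, dom T x -> `|T x| <= M%:C * `|x|.

(* Closedness of the graph is meant in E * F (subspace topology), and
   closedness of the range in F. *)
Definition closed_operator E F T : Prop :=
  linear_operator E F T /\ closed (op_graph T : set (subspace (E `*` F))).

Definition fredholm_operator E F T : Prop :=
  [/\ closed_operator E F T, finite_dim (ker T),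
      closed (ran T : set (subspace F)) & finite_codim F (ran T)].

(* F is the target space of T. *)
Definition op_index F T : int := (subspace_dim (ker T))%:Z - (subspace_codim F (ran T))%:Z.

End Operators.

Arguments operator {R} X.

Section Symplectic.
Context {R : realType} {X : completeNormedModType R[i]}.

(* {hermitian X for true & conj}: linear in the first variable, conjugate
   linear in the second, and omega y x = - (omega x y)^*. *)
Implicit Types omega : {hermitian X for true & @Num.conj R[i]}.

Definition symplectic omega : Prop :=
  (exists M : R, forall x y, `|omega x y| <= M%:C * `|x| * `|y|) /\
  (forall x, (forall y, omega x y = 0) -> x = 0).

Definition annihilator omega (lambda : set X) : set X :=
  [set y | forall x, lambda x -> omega x y = 0].

Definition isotropic omega (lambda : set X) : Prop :=
  is_subspace lambda /\ lambda `<=` annihilator omega lambda.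

Definition lagrangian omega (lambda : set X) : Prop :=
  is_subspace lambda /\ lambda = annihilator omega lambda.

(* In the order of R[i], 0 < z means that z is a positive real number. *)
Definition symplectic_splitting omega (Xp Xm : set X) : Prop :=
  [/\ is_subspace Xp /\ is_subspace Xm,
      subspace_sum Xp Xm = [set: X] /\ Xp `&` Xm = [set 0],
      forall x, Xp x -> x != 0 -> 0 < - 'i * omega x x,
      forall x, Xm x -> x != 0 -> - 'i * omega x x < 0 &
      forall x y, Xp x -> Xm y -> omega x y = 0].

(* lambda is the graph of U in X = Xp (+) Xm. *)
Definition generating_operator (Xp Xm lambda : set X) (U : operator X) : Prop :=
  [/\ linear_operator Xp Xm U, op_injective U &
      lambda = [set x + U x | x in dom U]].

End Symplectic.

(* Main.v *)
Require Import Defs.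
From HB Require Import structures.
From mathcomp Require Import all_boot all_order all_algebra.
From mathcomp Require Import all_classical all_reals all_analysis.
From mathcomp Require Import complex ring lra.

Set Implicit Arguments.
Unset Strict Implicit.
Unset Printing Implicit Defensive.

Import Order.TTheory GRing.Theory Num.Theory.
Import numFieldNormedType.Exports.

Local Open Scope classical_set_scope.
Local Open Scope ring_scope.
Local Open Scope complex_scope.

(** Everything happens in the coordinates given by the splitting. Let [P] be
    the projection onto [Xp] along [Xm]. The graph of a linear [T] from [Xp] to
    [Xm] is the set of those [z] for which [P z] is in the domain of [T] and
    [z - P z = T (P z)], so membership in [lambda] or [mu] is an equation
    between the two coordinates of [z].

    Algebra. Since [V] is defined on all of [Xp], the shear
    [Q z = z - P z - V (P z)] is the projection of [X] onto [Xm] along [mu]. It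
    sends [x + U x] to [(U - V) x]; hence [lambda + mu] is the preimage by [Q]
    of the range of [U - V] ([mem_sum_graphsP]), so that [Q] identifies the
    quotient of [X] by [lambda + mu] with the cokernel of [U - V]
    ([has_codim_retract]). Likewise [x + V x] is in [lambda] exactly
    when [U x = V x], so [lambda] meets [mu] in a copy of the kernel of [U - V]
    ([mem_cap_graphsP]). Substituting [y = V x] replaces [U - V] by
    [U V^-1 - I], with the same range and a kernel carried over by [V]. The
    equality of the indices follows.

    Topology. The closedness statements all have one form: a set is the preimage
    of another one by a continuous map built from [P], [V o P] and
    [V^-1 o (1 - P)]. This uses the boundedness of [V] and [V^-1], and it
    needs [P] to be continuous. The form [omega] does not define the
    topology of [X], so the continuity of [P] does not come from [omega] alone:
    [omega] gives that [Xp] and [Xm] are annihilators of each other, hence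
    closed, and a projection along closed complements of a Banach space is
    bounded by the open mapping argument ([closed_splitting_bounded]): Baire's
    theorem provides approximate decompositions with a uniform bound, and
    successive corrections make them exact.

    Symplectic geometry enters once more for (a): reducing a vector of the
    annihilator of [mu] modulo [mu] leaves some [w] in [Xm] that is orthogonal
    to the range of [V], which is [Xm]; so [w] is orthogonal to itself, and
    definiteness gives [w = 0]. *)

(** * Baire's theorem in a complex Banach space *)

Section ComplexBanach.
Context {R : realType} {X : completeNormedModType R[i]}.
Implicit Types (x y z : X) (A B : set X) (r e : R).

(** The norm of [X] takes its values in [R[i]], where the order is only
    partial; estimates are carried out on its real part, which determines it. *)
Definition rnorm x : R := complex.Re `|x|.

Lemma rnormE x : (rnorm x)%:C = `|x|.
Proof. by rewrite /rnorm RRe_real//; apply: (@normr_real R[i] X). Qed.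

Lemma rnorm_ge0 x : 0 <= rnorm x.
Proof. by rewrite -lecR rnormE; apply: (@normr_ge0 R[i] X). Qed.

Lemma rnorm0 : rnorm 0 = 0.
Proof. by rewrite /rnorm normr0. Qed.

Lemma rnorm_gt0 x : x != 0 -> 0 < rnorm x.
Proof. by move=> x0; rewrite -ltcR rnormE; rewrite (@normr_gt0 R[i] X). Qed.

Lemma rnormD x y : rnorm (x + y) <= rnorm x + rnorm y.
Proof. by rewrite -lecR rmorphD/= !rnormE; apply: (@ler_normD R[i] X). Qed.

Lemma rnormN x : rnorm (- x) = rnorm x.
Proof. by rewrite /rnorm normrN. Qed.

Lemma rnormB x y : rnorm (x - y) <= rnorm x + rnorm y.
Proof. by rewrite (le_trans (rnormD _ _))// rnormN. Qed.

Lemma rdistC x y : rnorm (x - y) = rnorm (y - x).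
Proof. by rewrite -rnormN opprB. Qed.

Lemma rdistD z x y : rnorm (x - y) <= rnorm (x - z) + rnorm (z - y).
Proof. by rewrite -[x - y](subrKA z) rnormD. Qed.

Lemma rnormZ r x : 0 <= r -> rnorm (r%:C *: x) = r * rnorm x.
Proof.
move=> r0; apply: complexI.
by rewrite rnormE normrZ rmorphM/= rnormE ger0_norm// lecR.
Qed.

Definition adherent A x :=
  forall e, 0 < e -> exists2 a, A a & rnorm (x - a) < e.

Lemma closed_adherent A x : closed A -> adherent A x -> A x.
Proof.
move=> clA adhx; apply: clA => B /nbhs_ballP[d /= d0 dB].
have dE : (complex.Re d)%:C = d by apply: RRe_real; exact: gtr0_real.
have [|a Aa xa] := adhx (complex.Re d); first by rewrite -ltcR dE.
exists a; split => //; apply: dB.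
by rewrite -ball_normE /= -rnormE -dE ltcR.
Qed.

(** Completeness in the form used below: the inequality between [u] and [r]
    says that the closed ball of centre [u n.+1] and radius [r n.+1] lies inside
    the previous one, so the limit belongs to all of them. *)
Lemma nested_balls (u : nat -> X) (r : nat -> R) :
    (forall n, 0 <= r n) ->
    (forall n, rnorm (u n.+1 - u n) + r n.+1 <= r n) ->
    (forall e, 0 < e -> exists n, r n < e) ->
  exists l, forall n, rnorm (l - u n) <= r n.
Proof.
move=> r0 ur rto0.
have dist n k : rnorm (u (n + k)%N - u n) + r (n + k)%N <= r n.
  elim: k => [|k ih]; first by rewrite addn0 subrr rnorm0 add0r.
  rewrite addnS.
  have := rdistD (u (n + k)%N) (u (n + k).+1) (u n).
  have := ur (n + k)%N; lra.
have ucvg : cvgn u.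
  apply: cauchy_cvg; apply: cauchy_exP => d d0.
  have dE : (complex.Re d)%:C = d by apply: RRe_real; exact: gtr0_real.
  have [|n rn] := rto0 (complex.Re d); first by rewrite -ltcR dE.
  exists (u n); exists n => // m /= nm.
  rewrite -ball_normE /= distrC -rnormE -dE ltcR.
  have := dist n (m - n)%N; rewrite subnKC//.
  have := r0 m; lra.
exists (limn u) => n; apply/ler_addgt0Pr => e e0.
have e0' : 0 < e%:C by rewrite ltcR.
have [N _ /(_ (N + n)%N)] := (cvgrPdist_lt _ _).1 ucvg _ e0'.
rewrite /= leq_addr => /(_ isT).
rewrite -rnormE ltcR => h.
have := rdistD (u (N + n)%N) (limn u) (u n).
have := dist n N; rewrite addnC; have := r0 (N + n)%N; lra.
Qed.

Lemma exists_geometric_lt (c e : R) : 0 < e -> exists n, c * 2^-1 ^+ n < e.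
Proof.
move=> e0.
have : (fun n => c * 2^-1 ^+ n) @ \oo --> (0 : R).
  rewrite -[X in _ --> X](mulr0 c); apply: cvgMr.
  by apply: cvg_expr; rewrite ger0_norm ?invr_ge0// invf_lt1 ?ltr1n.
move=> /cvgrPdist_lt/(_ _ e0)[N _ /(_ N)/(_ (leqnn N))] /=.
by rewrite sub0r normrN => h; exists N; exact: le_lt_trans (ler_norm _) h.
Qed.

(** If no [C n] were dense in a ball, one could choose balls inside each other,
    the next one avoiding [C n] and of at most half the radius; their common
    point would be in none of the sets. *)
Lemma baire_cover (C : nat -> set X) : (forall x, exists n, C n x) ->
  exists n x r, 0 < r /\ forall y, rnorm (y - x) < r -> adherent (C n) y.
Proof.
move=> cover; apply: contrapT => nint.
have step (a : nat * (X * R)) : exists b : X * R, 0 < a.2.2 ->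
    [/\ 0 < b.2, b.2 <= a.2.2 / 2, rnorm (b.1 - a.2.1) + b.2 <= a.2.2 &
        forall y, rnorm (y - b.1) <= b.2 -> ~ C a.1 y].
  have [s0|] := ltP 0 a.2.2; last by exists (0, 0); rewrite ltNge => /negP.
  have [y [ya nadh]] :
      exists y, rnorm (y - a.2.1) < a.2.2 / 2 /\ ~ adherent (C a.1) y.
    apply: contrapT => no; apply: nint; exists a.1, a.2.1, (a.2.2 / 2).
    split => [|y ya]; first by rewrite divr_gt0.
    by apply: contrapT => nadh; apply: no; exists y.
  have [e [e0 eC]] : exists e, 0 < e /\ forall c, C a.1 c -> e <= rnorm (y - c).
    apply: contrapT => no; apply: nadh => e e0; apply: contrapT => no2.
    apply: no; exists e; split => // c Cc; rewrite leNgt; apply/negP => lt.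
    by apply: no2; exists c.
  exists (y, Num.min (e / 2) (a.2.2 / 2)) => _ /=; split.
  - by rewrite lt_min !divr_gt0.
  - by rewrite ge_min lexx orbT.
  - have : Num.min (e / 2) (a.2.2 / 2) <= a.2.2 / 2 by rewrite ge_min lexx orbT.
    lra.
  - move=> c + /eC; rewrite rdistC le_min => /andP[]; lra.
have [f fP] := choice step.
pose b := fix b n := if n is m.+1 then f (m, b m) else ((0 : X), (1 : R)).
have b0 n : 0 < (b n).2 by elim: n => //= n ih; have [] := fP (n, b n) ih.
have bgeo n : (b n).2 <= 1 * 2^-1 ^+ n.
  elim: n => [|n ih]; first by rewrite expr0 mulr1.
  have [_ h _ _] := fP (n, b n) (b0 n).
  by rewrite (le_trans h)//= exprSr mulrA ler_wpM2r ?invr_ge0.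
have [||e e0|l lP] := @nested_balls (fst \o b) (snd \o b).
- by move=> n; exact/ltW/b0.
- by move=> n; have [] := fP (n, b n) (b0 n).
- have [n h] := exists_geometric_lt 1 e0.
  by exists n; exact: le_lt_trans (bgeo n) h.
have [n Cn] := cover l.
have [_ _ _ /(_ l (lP n.+1))] := fP (n, b n) (b0 n); exact.
Qed.

End ComplexBanach.

(** * Closed complements are boundedly complemented *)

Section Splitting.
Context {R : realType} {X : completeNormedModType R[i]}.
Implicit Types (x y z : X) (A B : set X) (r e : R).

Lemma is_subspaceP A : is_subspace A <->
  A 0 /\ forall (a : R[i]) x y, A x -> A y -> A (a *: x + y).
Proof.
split=> -[A0 lin]; split.
- exact/set_mem.
- by move=> a x y Ax Ay; apply/set_mem/lin; exact/mem_set.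
- exact/mem_set.
- by move=> a x y /set_mem Ax /set_mem Ay; apply/mem_set/lin.
Qed.

Lemma subspace0 A : is_subspace A -> A 0.
Proof. by case/is_subspaceP. Qed.

Lemma subspaceZ A (a : R[i]) x : is_subspace A -> A x -> A (a *: x).
Proof.
by case/is_subspaceP => A0 lin Ax; rewrite -[_ *: _]addr0; apply: lin.
Qed.

Lemma subspaceD A x y : is_subspace A -> A x -> A y -> A (x + y).
Proof.
by case/is_subspaceP => _ lin Ax Ay; rewrite -[x]scale1r; apply: lin.
Qed.

Lemma subspaceB A x y : is_subspace A -> A x -> A y -> A (x - y).
Proof.
case/is_subspaceP => _ lin Ax Ay.
by rewrite addrC -[- y]scaleN1r; apply: lin.
Qed.

(** First half of the open mapping argument. By Baire's theorem the sums
    [a + b] with [a] bounded by some [n] are dense in a ball of centre [x0]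
    and radius [r]. Subtracting approximations of [x0 + t y] and [x0], where
    [t y] has norm [r / 2], and dividing by [t] gives approximations of any
    [y] with a bound proportional to its norm. *)
Lemma adherent_sum_bounded A B :
    is_subspace A -> is_subspace B -> subspace_sum A B = [set: X] ->
  exists2 K, 0 <= K & forall y e, 0 < e -> exists a b,
    [/\ A a, B b, rnorm a <= K * rnorm y & rnorm (y - a - b) < e].
Proof.
move=> sA sB AB.
pose C n := [set x | exists a b,
  [/\ A a, B b, x = a + b & rnorm a <= n%:R]].
have [|n [x0 [r [r0 adhC]]]] := @baire_cover _ X C.
  move=> x; have [a Aa [b Bb <-]] : subspace_sum A B x by rewrite AB.
  exists (Num.truncn (rnorm a)).+1, a, b; split => //.
  exact/ltW/truncnS_gt.
exists (4 * n%:R / r) => [|y e e0]; first by rewrite divr_ge0// ?mulr_ge0// ltW.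
have [->|y0] := eqVneq y 0.
  exists 0, 0; rewrite !subr0 !rnorm0 mulr0.
  by split => //; exact: subspace0.
have ny0 := rnorm_gt0 y0.
pose t := r / 2 / rnorm y.
have t0 : 0 < t by rewrite !divr_gt0.
have te0 : 0 < t * e / 2 by apply: divr_gt0 => //; exact: mulr_gt0.
have tnz : t%:C != 0 by rewrite gt_eqF// ltcR.
have [|_ [a1 [b1 [Aa1 Bb1 -> na1]]] h1] := adhC (x0 + t%:C *: y) _ _ te0.
  rewrite addrAC subrr add0r rnormZ ?ltW// /t divfK ?gt_eqF//; lra.
have [|_ [a2 [b2 [Aa2 Bb2 -> na2]]] h2] := adhC x0 _ _ te0.
  by rewrite subrr rnorm0.
exists (t%:C^-1 *: (a1 - a2)), (t%:C^-1 *: (b1 - b2)).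
have Vt : t%:C^-1 = (t^-1)%:C by rewrite fmorphV.
split.
- by apply: subspaceZ => //; exact: subspaceB.
- by apply: subspaceZ => //; exact: subspaceB.
- rewrite Vt rnormZ; last by rewrite invr_ge0 ltW.
  rewrite /t invf_div.
  have := rnormB a1 a2 => h.
  have -> : 4 * n%:R / r * rnorm y = rnorm y / (r / 2) * (n%:R + n%:R).
    by field; rewrite gt_eqF.
  apply: ler_wpM2l; last by lra.
  by rewrite divr_ge0 ?ltW// divr_gt0.
- have -> : y - t%:C^-1 *: (a1 - a2) - t%:C^-1 *: (b1 - b2) =
      (t^-1)%:C *: ((x0 + t%:C *: y - (a1 + b1)) - (x0 - (a2 + b2))).
    rewrite -Vt -[in LHS](scalerK tnz y) -!scalerBr; congr (_ *: _).
    rewrite !opprB opprD !addrA.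
    by rewrite [RHS](ACl (1*7*2*5*3*6*4))/= subrr add0r.
  rewrite rnormZ ?invr_ge0 ?ltW// mulrC ltr_pdivrMr//.
  have := rnormB (x0 + t%:C *: y - (a1 + b1)) (x0 - (a2 + b2)); lra.
Qed.

(** Second half: approximate [x], then the remainder, and so on, with errors
    halved at each step. The corrections in [A] are dominated by a geometric
    series, whence the factor [2] in the bound [2 * K]; closedness of [A] and
    [B] keeps the limits inside them. *)
Lemma closed_splitting_bounded A B :
    is_subspace A -> is_subspace B -> closed A -> closed B ->
    subspace_sum A B = [set: X] ->
  exists M : R, forall x, exists a,
    [/\ A a, B (x - a) & rnorm a <= M * rnorm x].
Proof.
move=> sA sB cA cB AB.
have [K K0 approx] := adherent_sum_bounded sA sB AB.
exists (2 * K) => x.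
have [->|x0] := eqVneq x 0.
  by exists 0; rewrite rnorm0 mulr0 subr0; split=> //; exact: subspace0.
have nx0 := rnorm_gt0 x0.
pose c n : R := rnorm x * 2^-1 ^+ n.
have c0 n : 0 < c n by rewrite mulr_gt0 ?exprn_gt0 ?invr_gt0.
have cS n : c n = 2 * c n.+1 by rewrite /c exprS; field.
have step (p : nat * (X * X)) : exists q : X * X,
    [/\ A q.1, B q.2, rnorm q.1 <= K * rnorm (x - p.2.1 - p.2.2) &
      rnorm (x - p.2.1 - p.2.2 - q.1 - q.2) < c p.1.+1].
  have [a [b []]] := approx (x - p.2.1 - p.2.2) _ (c0 p.1.+1).
  by exists (a, b).
have [f fP] := choice step.
(* The accumulated components in [A] and in [B] after [n] corrections. *)
pose s := fix s n := if n is m.+1 then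
  ((s m).1 + (f (m, s m)).1, (s m).2 + (f (m, s m)).2) else ((0, 0) : X * X).
have sAn n : A (s n).1.
  elim: n => [|n ih]; first exact: subspace0.
  by apply: subspaceD => //; have [] := fP (n, s n).
have sBn n : B (s n).2.
  elim: n => [|n ih]; first exact: subspace0.
  by apply: subspaceD => //; have [] := fP (n, s n).
have rem n : rnorm (x - (s n).1 - (s n).2) <= c n.
  case: n => [|n]; first by rewrite /= !subr0 /c expr0 mulr1.
  have [_ _ _ /ltW] := fP (n, s n); rewrite /=.
  congr (rnorm _ <= _).
  by rewrite !opprD !addrA [in RHS](addrAC _ (- (f _).1)).
have [|||a aP] := @nested_balls _ X (fst \o s) (fun n => 2 * K * c n).
- by move=> n; rewrite !mulr_ge0// ltW.
- move=> n /=; rewrite addrAC subrr add0r.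
  have [_ _ h _] := fP (n, s n); have := rem n => h2.
  have : K * rnorm (x - (s n).1 - (s n).2) <= K * c n by rewrite ler_wpM2l.
  rewrite (cS n) /= in h *; lra.
- move=> e e0; have [n h] := exists_geometric_lt (2 * K * rnorm x) e0.
  by exists n; rewrite /c mulrA.
exists a; split.
- apply: closed_adherent => // e e0.
  have [n h] := exists_geometric_lt (2 * K * rnorm x) e0.
  by exists (s n).1 => //; rewrite (le_lt_trans (aP n))// /c mulrA.
- apply: closed_adherent => // e e0.
  have [n h] := exists_geometric_lt ((2 * K + 1) * rnorm x) e0.
  exists (s n).2 => //.
  have := rnormB (x - (s n).1 - (s n).2) (a - (s n).1).
  have -> : x - (s n).1 - (s n).2 - (a - (s n).1) = x - a - (s n).2.
    by rewrite opprB !addrA (ACl (1*5*3*2*4))/= subrK.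
  have := aP n; have := rem n; rewrite /c /=; rewrite -mulrA in h; lra.
- by have := aP 0%N; rewrite /= subr0 /c expr0 mulr1.
Qed.

End Splitting.

(** * Continuous projections, transport of dimension and codimension *)

Section Transport.
Context {R : realType} {X : completeNormedModType R[i]}.
Implicit Types (x y z : X) (A B : set X).

Lemma bounded_linear_cont (f : {linear X -> X}) (M : R) :
  (forall x, `|f x| <= M%:C * `|x|) -> continuous f.
Proof.
move=> fM; apply: bounded_linear_continuous; apply/bounded_funP => r.
exists (`|M|%:C * r) => x xr; apply: (le_trans (fM x)).
have h : M%:C <= `|M|%:C by rewrite lecR ler_norm.
apply: (le_trans (ler_wpM2r _ h)); first exact: (@normr_ge0 R[i] X).
by rewrite ler_wpM2l// lecR.
Qed.

Lemma exists_projection A B :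
    is_subspace A -> is_subspace B -> closed A -> closed B ->
    subspace_sum A B = [set: X] -> A `&` B = [set 0] ->
  exists P : {linear X -> X},
    [/\ forall x, A (P x), forall x, B (x - P x) & continuous P].
Proof.
move=> sA sB cA cB AB A0B.
have [M hM] := closed_splitting_bounded sA sB cA cB AB.
have [p pP] := choice hM.
have uniq x a : A a -> B (x - a) -> p x = a.
  move=> Aa Ba; have [Ap Bp _] := pP x.
  apply/eqP; rewrite -subr_eq0; apply/eqP.
  suff : (A `&` B) (p x - a) by rewrite A0B.
  split; first exact: subspaceB.
  by rewrite -[p x - a](subrKA x) -opprB addrC; apply: subspaceB.
have plin : linear p.
  move=> a x y; have [Ax Bx _] := pP x; have [Ay By _] := pP y.
  apply: uniq; first by apply: subspaceD => //; exact: subspaceZ.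
  rewrite opprD addrACA -scalerBr; apply: subspaceD => //; exact: subspaceZ.
pose P : {linear X -> X} := HB.pack p (GRing.isLinear.Build _ _ _ _ _ plin).
exists P; split=> [x|x|]; [by have [] := pP x| by have [] := pP x|].
apply: (@bounded_linear_cont P M) => x.
by rewrite -!rnormE -rmorphM/= lecR; have [] := pP x.
Qed.

Lemma has_dim_iso A B (f g : {linear X -> X}) n :
    (forall x, A x -> B (f x)) -> (forall y, B y -> A (g y)) ->
    (forall x, A x -> g (f x) = x) -> (forall y, B y -> f (g y) = y) ->
  has_dim A n -> has_dim B n.
Proof.
move=> AB BA gf fg [e [Ae free span]].
exists (f \o e); split => [i|a a0|y By] /=; first exact/AB/Ae.
  apply: free; transitivity (g (\sum_i a i *: (f \o e) i)).
    by rewrite linear_sum; apply: eq_bigr => i _; rewrite linearZ/= gf.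
  by rewrite a0 linear0.
have [a ya] := span _ (BA _ By); exists a.
rewrite -[LHS]fg// ya [LHS]linear_sum.
by apply: eq_bigr => i _; rewrite linearZ.
Qed.

(** A retraction [q] of [X] onto [A] under which [S] is the preimage of [B]
    induces an isomorphism from [X / S] to [A / B]; a basis of the latter is
    already a basis of the former. *)
Lemma has_codim_retract A S B (q : {linear X -> X}) n :
    (forall x, A (q x)) -> (forall y, A y -> q y = y) ->
    (forall x, S x <-> B (q x)) ->
  has_codim [set: X] S n <-> has_codim A B n.
Proof.
move=> Aq qA SB.
have qsum m (a : 'I_m -> R[i]) e :
    q (\sum_i a i *: e i) = \sum_i a i *: q (e i).
  by rewrite linear_sum; apply: eq_bigr => i _; rewrite linearZ.
split=> -[e [Ae free span]].
  exists (q \o e); split => [i|a aB|y Ay] //=.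
    by apply: free; apply/SB; rewrite qsum.
  have [a /SB] := span y Logic.I; rewrite linearB qsum qA// => h.
  by exists a.
have qe i : q (e i) = e i by exact: qA.
exists e; split => [//|a /SB|x _].
  rewrite qsum; under eq_bigr do rewrite qe; exact: free.
have [a h] := span _ (Aq x); exists a; apply/SB; rewrite linearB qsum.
by under eq_bigr do rewrite qe.
Qed.

End Transport.

(** * Inverses and continuous extensions of operators *)

Section Operators.
Context {R : realType} {X : completeNormedModType R[i]}.
Implicit Types (x y z : X) (E F : set X) (T : operator X).

Lemma linear_operator_ran_subspace E F T :
  linear_operator E F T -> is_subspace (ran T).
Proof.
move=> [sD _ _ lin]; apply/is_subspaceP; split.
  exists 0; first exact: subspace0.
  have := lin (- 1) 0 0 (subspace0 sD) (subspace0 sD).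
  by rewrite scaleN1r oppr0 addr0 scaleN1r addNr.
move=> a _ _ [x Dx <-] [y Dy <-]; exists (a *: x + y); last exact: lin.
by case/is_subspaceP: sD => _; apply.
Qed.

Lemma op_invK T x : op_injective T -> dom T x -> op_inv T (T x) = x.
Proof.
move=> inj Dx; apply: pinvKV; last exact/mem_set.
by move=> u v /set_mem Du /set_mem Dv; exact: inj.
Qed.

Lemma op_inv_linear E F T : op_injective T -> linear_operator E F T ->
  linear_operator F E (op_inv T).
Proof.
move=> inj lT; have sR := linear_operator_ran_subspace lT.
have [sD DE RF lin] := lT; split => //.
  by move=> _ [_ [x Dx <-] <-]; rewrite op_invK//; exact: DE.
move=> a _ _ [x Dx <-] [y Dy <-].
have Dxy : dom T (a *: x + y) by case/is_subspaceP: sD => _; apply.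
by rewrite -lin// !op_invK.
Qed.

(** Composing with a projection onto the domain turns a bounded operator into
    a continuous linear map on all of [X], so that closedness questions become
    questions about preimages in [X]. *)
Lemma bounded_operator_extend E F T (P : {linear X -> X}) :
    linear_operator E F T -> bounded_operator T ->
    (forall x, dom T (P x)) -> continuous P ->
  exists W : {linear X -> X}, (forall x, W x = T (P x)) /\ continuous W.
Proof.
move=> [sD _ _ lin] [M TM] DP cP.
have Wlin : linear (fun x => T (P x)) by move=> a x y; rewrite linearP lin.
pose W : {linear X -> X} := HB.pack (fun x => T (P x))
  (GRing.isLinear.Build _ _ _ _ _ Wlin).
exists W; split => //.
have /linear_bounded_continuous/linear_boundedP/pinfty_ex_gt0[N N0 PN] := cP.
have NE : (complex.Re N)%:C = N by apply: RRe_real; exact: gtr0_real.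
apply: (@bounded_linear_cont _ _ W (`|M| * complex.Re N)) => x.
apply: (le_trans (TM _ (DP x))); rewrite rmorphM/= NE -mulrA.
have h : M%:C <= `|M|%:C by rewrite lecR ler_norm.
apply: (le_trans (ler_wpM2r _ h)); first exact: (@normr_ge0 R[i] X).
by rewrite ler_wpM2l// lecR.
Qed.

End Operators.

(** * Graphs over a topological splitting

    Only the decomposition of [X] along [P] matters in this part. [W] and [W']
    stand for [V o P] and [V^-1 o (1 - P)], the continuous extensions of
    [V] and [V^-1] by zero on the complementary summand. *)

Section Graphs.
Context {R : realType} {X : completeNormedModType R[i]}.
Implicit Types (x y z w : X) (T : operator X).
Context (Xp Xm : set X).
Context (subXp : is_subspace Xp) (subXm : is_subspace Xm).
Context (Xp0m : Xp `&` Xm = [set 0]).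
Context (P : {linear X -> X}).
Context (XpP : forall x, Xp (P x)) (XmP : forall x, Xm (x - P x)).

Lemma projD x y : Xp x -> Xm y -> P (x + y) = x.
Proof.
move=> px my; apply/eqP; rewrite -subr_eq0; apply/eqP.
suff : (Xp `&` Xm) (P (x + y) - x) by rewrite Xp0m.
split; first exact: subspaceB.
have -> : P (x + y) - x = y - (x + y - P (x + y)).
  by rewrite opprB addrCA opprD [y + _]addrCA subrr addr0.
exact: subspaceB.
Qed.

Lemma proj_id x : Xp x -> P x = x.
Proof. by move=> px; rewrite -[x in LHS]addr0 projD//; exact: subspace0. Qed.

Lemma proj_eq0 y : Xm y -> P y = 0.
Proof. by move=> my; rewrite -[y in LHS]add0r projD//; exact: subspace0. Qed.

Lemma mem_graphP T z : linear_operator Xp Xm T ->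
  [set x + T x | x in dom T] z <-> dom T (P z) /\ z - P z = T (P z).
Proof.
move=> [_ DXp RXm _]; split=> [[x Dx <-]|[Dz e]]; last first.
  by exists (P z) => //; rewrite -e addrC subrK.
have Px : P (x + T x) = x by rewrite projD//; [exact: DXp|apply: RXm; exists x].
by rewrite Px; split => //; rewrite addrAC subrr add0r.
Qed.

Context (U V : operator X).
Context (linU : linear_operator Xp Xm U) (linV : linear_operator Xp Xm V).
Context (injV : op_injective V) (domV : dom V = Xp) (ranV : ran V = Xm).
Context (contP : continuous P).
Context (W W' : {linear X -> X}).
Context (WE : forall x, W x = V (P x)) (contW : continuous W).
Context (W'E : forall x, W' x = op_inv V (x - P x)) (contW' : continuous W').

Let D := op_sub U V.
Let T := op_sub (op_comp U (op_inv V)) (op_id Xm).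
Let lambda : set X := [set x + U x | x in dom U].
Let mu : set X := [set x + V x | x in dom V].

Lemma XmV x : Xp x -> Xm (V x).
Proof. by rewrite -domV -ranV => Dx; exists x. Qed.

Lemma WV x : Xp x -> W x = V x.
Proof. by move=> px; rewrite WE proj_id. Qed.

Lemma W_eq0 y : Xm y -> W y = 0.
Proof. by move=> my; rewrite WE proj_eq0// -[RHS](linear0 W) WE linear0. Qed.

Lemma XmW x : Xm (W x).
Proof. by rewrite WE; exact: XmV. Qed.

Lemma W'V x : Xp x -> W' (V x) = x.
Proof.
by move=> px; rewrite W'E proj_eq0 ?subr0 ?op_invK ?domV//; exact: XmV.
Qed.

Lemma W'inv y : Xm y -> W' y = op_inv V y.
Proof. by move=> my; rewrite W'E proj_eq0// subr0. Qed.

Lemma XpW' y : Xp (W' y).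
Proof.
have : Xm (y - P y) by []; rewrite W'E -[Xm]ranV => -[x Dx <-].
by rewrite op_invK// -domV.
Qed.

Lemma VW' y : Xm y -> V (W' y) = y.
Proof.
move=> my; rewrite W'inv//; move: my; rewrite -ranV => -[x Dx <-].
by rewrite op_invK.
Qed.

Lemma dom_subE : dom D = dom U.
Proof.
by have [_ DXp _ _] := linU; rewrite /D /= domV; apply/setIidl.
Qed.

Lemma dom_compP y : dom T y <-> Xm y /\ dom U (W' y).
Proof.
split=> [[[Ry Dy] my]|[my Dy]]; first by split=> //; rewrite W'inv.
by split=> //; split; [rewrite /= ranV|rewrite W'inv in Dy].
Qed.

Lemma comp_subE y : Xm y -> T y = U (W' y) - y.
Proof. by move=> my; rewrite W'inv. Qed.

Lemma dom_compE : dom T = V @` dom U.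
Proof.
have [_ DXp _ _] := linU.
apply/seteqP; split=> [y /dom_compP[my Dy]|_ [x Dx <-]].
  by exists (W' y) => //; exact: VW'.
by apply/dom_compP; rewrite W'V; [split=> //; apply: XmV|]; exact: DXp.
Qed.

Lemma lin_sub : linear_operator Xp Xm D.
Proof.
have [sU DXp RXm lU] := linU; have [_ _ _ lV] := linV.
split; rewrite ?dom_subE//.
- move=> w [x]; rewrite dom_subE => Dx <-; apply: subspaceB => //.
    by apply: RXm; exists x.
  exact/XmV/DXp.
- move=> a x y Dx Dy; rewrite /D /= lU// lV ?domV; [|exact: DXp..].
  by rewrite opprD addrACA scalerBr.
Qed.

Lemma lin_comp_sub : linear_operator Xm Xm T.
Proof.
have [sU DXp RXm lU] := linU.
split.
- apply/is_subspaceP; split.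
    by apply/dom_compP; rewrite linear0; split; exact: subspace0.
  move=> a x y /dom_compP[mx Dx] /dom_compP[my Dy]; apply/dom_compP.
  rewrite linearP.
  by split; [case/is_subspaceP: subXm|case/is_subspaceP: sU] => _; apply.
- by move=> x /dom_compP[].
- move=> w [y /dom_compP[my Dy] <-]; rewrite comp_subE//.
  apply: subspaceB => //.
  by apply: RXm; exists (W' y).
- move=> a x y /dom_compP[mx Dx] /dom_compP[my Dy]; rewrite !comp_subE//.
    by rewrite linearP lU// opprD addrACA scalerBr.
  by case/is_subspaceP: subXm => _; apply.
Qed.

(** For [x] in [Xp] and [w] in [Xm], [w = U x - V x] means that
    [x + (w + V x)] is in [lambda]: the graph is the trace on [Xp `*` Xm] of the
    preimage of [lambda] by a continuous map. *)
Lemma closed_graph_sub : closed lambda -> closed_operator Xp Xm D.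
Proof.
move=> cl; split; first exact: lin_sub.
apply/closed_subspaceP.
exists ((fun p : X * X => p.1 + (p.2 + W p.1)) @^-1` lambda).
  apply: preimage_closed => // p _.
  apply: cvgD; first exact: cvg_fst.
  apply: cvgD; first exact: cvg_snd.
  by apply: continuous_comp; [exact: cvg_fst|exact: contW].
apply/seteqP; split=> -[x w] [/= h [/= px mw]]; split=> //=.
  have mV : Xm (w + W x) by apply: subspaceD => //; exact: XmW.
  move/mem_graphP: h => /(_ linU); rewrite projD// => -[Dx e].
  exists x; first by rewrite dom_subE.
  rewrite /D /= -e -(WV px); congr (_, _).
  by rewrite [x + _]addrC !addrK.
case: h => x' + [xE <-]; rewrite xE dom_subE => Dx.
by exists x => //; rewrite WV// /D /= subrK.
Qed.

(** Same argument after the substitution [x = V^-1 y]. *)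
Lemma closed_graph_comp_sub : closed lambda -> closed_operator Xm Xm T.
Proof.
move=> cl; split; first exact: lin_comp_sub.
apply/closed_subspaceP.
exists ((fun p : X * X => W' p.1 + (p.2 + p.1)) @^-1` lambda).
  apply: preimage_closed => // p _.
  apply: cvgD; first by apply: continuous_comp; [exact: cvg_fst|exact: contW'].
  by apply: cvgD; [exact: cvg_snd|exact: cvg_fst].
apply/seteqP; split=> -[y w] [/= h [/= my mw]]; split=> //=.
  have mV : Xm (w + y) by exact: subspaceD.
  move/mem_graphP: h => /(_ linU); rewrite projD//; last exact: XpW'.
  move=> [Dy e]; exists y; first exact/dom_compP.
  rewrite comp_subE// -e; congr (_, _).
  by rewrite [W' y + _]addrC !addrK.
case: h => y' /dom_compP[my' Dy] /esym/pair_equal_spec[-> ->].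
rewrite comp_subE// subrK.
by exists (W' y').
Qed.


(** The projection onto [Xm] along [mu]. *)
Let q z := z - P z - W z.

Lemma q_linear : linear q.
Proof.
move=> a x y; rewrite /q (linearP P) (linearP W) !opprD.
rewrite (addrACA (a *: x)) (addrACA (a *: x - _)).
by rewrite -!scalerBr.
Qed.

Let Q : {linear X -> X} := HB.pack q (GRing.isLinear.Build _ _ _ _ _ q_linear).

Lemma contQ : continuous Q.
Proof.
move=> z; apply: cvgB; last exact: contW.
by apply: cvgB; [exact: cvg_id|exact: contP].
Qed.

Lemma XmQ z : Xm (Q z).
Proof. by apply: subspaceB => //; exact: XmW. Qed.

Lemma Q_id y : Xm y -> Q y = y.
Proof. by move=> my; rewrite /= /q proj_eq0// W_eq0// !subr0. Qed.

(** Converse of [closed_graph_comp_sub]: [lambda] is the preimage of the graph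
    by [z |-> (V (P z), Q z)], which takes its values in [Xm `*` Xm], so a graph
    closed relatively to this product is enough. *)
Lemma closed_graph_comp_sub_inv : closed_operator Xm Xm T -> closed lambda.
Proof.
move=> [_ /closed_subspaceP[G cG GT]].
suff -> : lambda = (fun z => (W z, Q z)) @^-1` G.
  apply: preimage_closed => // z _.
  by apply: cvg_pair; [exact: contW|exact: contQ].
apply/seteqP; split=> z.
  move=> /mem_graphP => /(_ linU)[Dz e].
  have : (G `&` (Xm `*` Xm)) (W z, Q z); last by case.
  rewrite GT; split; last by split; [exact: XmW|exact: XmQ].
  exists (W z); first by apply/dom_compP; split; [exact: XmW|rewrite WE W'V].
  rewrite comp_subE; last exact: XmW.
  by rewrite WE W'V// -WE /= /q e WE.
move=> /= Gz.
have : (G `&` (Xm `*` Xm)) (W z, Q z).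
  by split => //; split; [exact: XmW|exact: XmQ].
rewrite GT => -[[y /dom_compP[my Dy] /pair_equal_spec[yE QE]] _].
have W'W : W' (W z) = P z by rewrite WE W'V.
move: QE; rewrite comp_subE// /= /q yE W'W => /addIr e.
by apply/mem_graphP => //; split => //; rewrite -W'W -yE.
Qed.

(** Modulo [mu], the vector [x + U x] is [U x - V x], and [Q] kills exactly
    [mu]. *)
Lemma mem_sum_graphsP z : subspace_sum lambda mu z <-> ran D (Q z).
Proof.
split.
  move=> [_ [x Dx <-] [_ [y Dy <-] <-]].
  exists x; first by rewrite dom_subE.
  have px : Xp x by case: linU => _ + _ _; apply.
  have mUx : Xm (U x) by case: linU => _ _ + _; apply; exists x.
  rewrite domV in Dy; have mVy := XmV Dy.
  have pxy : Xp (x + y) by exact: subspaceD.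
  have mUV : Xm (U x + V y) by exact: subspaceD.
  rewrite addrACA /= /q WE projD// [x + y + _]addrC addrK -(WV pxy) linearD.
  by rewrite !WV// opprD addrACA subrr addr0.
move=> [x]; rewrite dom_subE => Dx e.
have px : Xp x by case: linU => _ + _ _; apply.
exists (x + U x); first by exists x.
exists ((P z - x) + V (P z - x)).
  by exists (P z - x) => //; rewrite domV; exact: subspaceB.
have pzx : Xp (P z - x) by exact: subspaceB.
rewrite -(WV pzx) linearB/= (WV px) WE (proj_id (XpP z)) addrACA.
rewrite [x + _]addrC subrK [U x + _]addrCA.
move: e; rewrite /D /= /q WE => ->.
by rewrite [V _ + _]addrC subrK addrC subrK.
Qed.

Lemma ran_compE : ran T = ran D.
Proof.
apply/seteqP; split=> [w [y /dom_compP[my Dy] <-]|w [x]].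
  by exists (W' y); rewrite ?dom_subE// comp_subE// /D /= VW'.
rewrite dom_subE => Dx <-.
have px : Xp x by case: linU => _ + _ _; apply.
exists (V x); first by apply/dom_compP; rewrite W'V//; split => //; exact: XmV.
by rewrite comp_subE ?W'V//; exact: XmV.
Qed.

Lemma mem_cap_graphsP z : (lambda `&` mu) z <-> ker D (P z) /\ z - P z = W z.
Proof.
split=> [[zl zm]|[]].
  have [[Dz eU] [_ eV]] := ((mem_graphP z linU).1 zl, (mem_graphP z linV).1 zm).
  by split; [split; rewrite ?dom_subE// /D /= -eU -eV subrr|rewrite WE].
rewrite /ker /mkset dom_subE => -[Dz /eqP]; rewrite subr_eq0 => /eqP e eW.
by split; apply/mem_graphP => //; rewrite ?e -?WE ?domV.
Qed.

Lemma ker_compP y : ker T y <-> Xm y /\ ker D (W' y).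
Proof.
rewrite /ker /mkset dom_subE; split=> [[/dom_compP[my Dy]]|[my [Dy]]].
  by rewrite comp_subE// /D /= VW'.
rewrite /D /= VW'// => e.
by split; [exact/dom_compP|rewrite -[LHS]/(T y) comp_subE].
Qed.


Lemma W_W' y : Xm y -> W (W' y + y) = y.
Proof.
by move=> my; rewrite WE projD//; [exact: VW'|exact: XpW'].
Qed.

Lemma W'_W z : W' (W z) = P z.
Proof. by rewrite WE W'V. Qed.

(** The isomorphism is [x + V x |-> V x]: it extends to [W] on all of [X], and
    its inverse [y |-> V^-1 y + y] to [W' + 1]. *)
Lemma has_dim_cap_comp n : has_dim (lambda `&` mu) n <-> has_dim (ker T) n.
Proof.
pose f : {linear X -> X} := W.
pose g : {linear X -> X} := (W' \+ idfun).
have fT z : (lambda `&` mu) z -> ker T (f z).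
  move=> /mem_cap_graphsP[Kz _]; apply/ker_compP.
  by rewrite /f W'_W; split => //; exact: XmW.
have gl y : ker T y -> (lambda `&` mu) (g y).
  move=> /ker_compP[my Ky]; apply/mem_cap_graphsP.
  rewrite /= W_W'// projD//; last exact: XpW'.
  by rewrite addrAC subrr add0r.
have gf z : (lambda `&` mu) z -> g (f z) = z.
  by move=> /mem_cap_graphsP[_ e]; rewrite /= /f W'_W -e addrC subrK.
have fg y : ker T y -> f (g y) = y.
  by move=> /ker_compP[my _]; rewrite /f /= W_W'.
by split; [exact: (@has_dim_iso _ _ _ _ f g)|exact: (@has_dim_iso _ _ _ _ g f)].
Qed.

Lemma has_dim_cap_sub n : has_dim (lambda `&` mu) n -> has_dim (ker D) n.
Proof.
pose g : {linear X -> X} := (idfun \+ W).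
have kerXp x : ker D x -> Xp x.
  by move=> []; rewrite dom_subE => Dx _; case: linU => _ + _ _; apply.
apply: (@has_dim_iso _ _ _ _ P g).
- by move=> z /mem_cap_graphsP[].
- move=> x Kx; have px := kerXp x Kx; apply/mem_cap_graphsP.
  rewrite /= projD//; last exact: XmW.
  split => //; rewrite addrAC subrr add0r linearD/= (W_eq0 (XmW x)) addr0 //.
- by move=> z /mem_cap_graphsP[_ e]; rewrite /= (WV (XpP z)) -WE -e addrC subrK.
- by move=> x Kx; rewrite /= projD//; [exact: kerXp|exact: XmW].
Qed.

Lemma has_codim_sum n :
  has_codim [set: X] (subspace_sum lambda mu) n <-> has_codim Xm (ran D) n.
Proof.
apply: (has_codim_retract (q := Q)); first exact: XmQ.
  exact: Q_id.
exact: mem_sum_graphsP.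
Qed.

(** On [Xm] the shear [Q] is the identity, so the range is also the trace of
    [lambda + mu] on [Xm]; this gives the direct implication, and
    [mem_sum_graphsP] the other one. *)
Lemma closed_sumP :
  closed (subspace_sum lambda mu) <-> closed (ran D : set (subspace Xm)).
Proof.
split=> [cS|/closed_subspaceP[G cG GD]].
  apply/closed_subspaceP; exists (subspace_sum lambda mu) => //.
  have e y : Xm y -> subspace_sum lambda mu y <-> ran D y.
    by move=> my; rewrite -{2}(Q_id my); exact: mem_sum_graphsP.
  by apply/seteqP; split=> y [h my]; split=> //; apply/(e y my).
have -> : subspace_sum lambda mu = Q @^-1` G.
  apply/seteqP; split=> z.
    move=> h; have : (ran D `&` Xm) (Q z).
      by split; [exact/mem_sum_graphsP|exact: XmQ].
    by rewrite -GD => -[].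
  move=> Gz; have : (G `&` Xm) (Q z) by split => //; exact: XmQ.
  by rewrite GD => -[? _]; exact/mem_sum_graphsP.
by apply: preimage_closed => // z _; exact: contQ.
Qed.

Lemma closed_mu : closed mu.
Proof.
have -> : mu = Q @^-1` [set 0].
  apply/seteqP; split=> z.
    move=> zm; have [_ e] := (mem_graphP z linV).1 zm.
    by rewrite /= /q e -WE subrr.
  move=> /= /eqP; rewrite /q subr_eq0 => /eqP e; apply/mem_graphP => //.
  by rewrite domV e WE.
apply: preimage_closed => [z _|]; first exact: contQ.
exact: (accessible_closed_set1 (hausdorff_accessible (@norm_hausdorff _ X))).
Qed.

Lemma fredholm_pair_comp :
  fredholm_pair lambda mu <-> fredholm_operator Xm Xm T.
Proof.
rewrite /fredholm_pair /fredholm_operator ran_compE.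
split=> [[cl _ cS [n hn] [m hm]]|[cT [n hn] cR [m hm]]].
  split; first exact: closed_graph_comp_sub.
  - by exists n; apply/has_dim_cap_comp.
  - exact/closed_sumP.
  - by exists m; apply/has_codim_sum.
split; [exact: closed_graph_comp_sub_inv|exact: closed_mu|exact/closed_sumP| |].
- by exists n; apply/has_dim_cap_comp.
- by exists m; apply/has_codim_sum.
Qed.

Lemma fredholm_pair_sub : fredholm_pair lambda mu -> fredholm_operator Xp Xm D.
Proof.
move=> [cl _ cS [n hn] [m hm]]; split; first exact: closed_graph_sub.
- by exists n; apply: has_dim_cap_sub.
- exact/closed_sumP.
- by exists m; apply/has_codim_sum.
Qed.

Lemma pair_index_comp : pair_index lambda mu = op_index Xm T.
Proof.
rewrite /pair_index /op_index /subspace_dim /subspace_codim ran_compE.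
congr ((xget _ _)%:Z - (xget _ _)%:Z); apply/seteqP; split=> n /=.
- by move/has_dim_cap_comp.
- by move/has_dim_cap_comp.
- by move/has_codim_sum.
- by move/has_codim_sum.
Qed.

End Graphs.

(** * Symplectic splittings *)

Section Symplectic.
Context {R : realType} {X : completeNormedModType R[i]}.
Context (omega : {hermitian X for true & @Num.conj R[i]}).
Implicit Types (x y z : X) (A S : set X).

Lemma adherent_closed A : (forall x, adherent A x -> A x) -> closed A.
Proof.
move=> h x clx; apply: h => e e0.
have [|a [Aa xa]] := clx (ball x e%:C).
  by apply: nbhsx_ballx; rewrite ltcR.
by exists a => //; move: xa; rewrite -ball_normE /= -rnormE ltcR.
Qed.

Lemma omegaDl x y z : omega (x + y) z = omega x z + omega y z.
Proof. exact: linearDl. Qed.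

Lemma omegaDr x y z : omega x (y + z) = omega x y + omega x z.
Proof. exact: linearDr. Qed.

Lemma omegaBr x y z : omega x (y - z) = omega x y - omega x z.
Proof. exact: linearBr. Qed.

Lemma symplectic_antisym x y : omega x y = 0 -> omega y x = 0.
Proof. by move=> xy; rewrite hermC xy rmorph0 mulr0. Qed.

Lemma closed_annihilator S : symplectic omega -> closed (annihilator omega S).
Proof.
move=> [[M hM] _]; apply: adherent_closed => y adhy x Sx.
apply/eqP; rewrite -normr_le0.
have cE : (complex.Re `|omega x y|)%:C = `|omega x y|.
  by apply: RRe_real; apply: normr_real.
rewrite -cE lecR leNgt; apply/negP.
set c := complex.Re _ => c0.
pose K := `|M| * rnorm x + 1.
have K0 : 0 < K by rewrite ltr_wpDl// mulr_ge0// rnorm_ge0.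
have [a Sa ya] := adhy _ (divr_gt0 c0 K0).
have : c%:C <= (M * rnorm x * rnorm (y - a))%:C.
  rewrite !rmorphM/= !rnormE cE.
  by rewrite (_ : omega x y = omega x (y - a)) ?hM// omegaBr Sa// subr0.
rewrite lecR => h.
have Mx : M * rnorm x <= K.
  by rewrite -[leLHS]addr0 lerD// ler_wpM2r ?ler_norm ?rnorm_ge0.
have : c < c; last by rewrite ltxx.
apply: (le_lt_trans h); apply: (@le_lt_trans _ _ (K * rnorm (y - a))).
  by rewrite ler_wpM2r ?rnorm_ge0.
by rewrite mulrC -ltr_pdivlMr.
Qed.

Context (Xp Xm : set X).

Lemma splitting_decomp z : symplectic_splitting omega Xp Xm ->
  exists x y, [/\ Xp x, Xm y & z = x + y].
Proof.
move=> [_ [sumX _] _ _ _].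
have [x px [y my <-]] : subspace_sum Xp Xm z by rewrite sumX.
by exists x, y.
Qed.

(** Definiteness rules out nonzero null vectors in either summand. *)
Lemma splitting_null_p x : symplectic_splitting omega Xp Xm ->
  Xp x -> omega x x = 0 -> x = 0.
Proof.
move=> [_ _ pos _ _] px xx; apply: contrapT => /eqP x0.
by have := pos x px x0; rewrite xx mulr0 ltxx.
Qed.

Lemma splitting_null_m x : symplectic_splitting omega Xp Xm ->
  Xm x -> omega x x = 0 -> x = 0.
Proof.
move=> [_ _ _ neg _] mx xx; apply: contrapT => /eqP x0.
by have := neg x mx x0; rewrite xx mulr0 ltxx.
Qed.

(** The [Xp]-component of a vector orthogonal to [Xp] is orthogonal to itself.
    With [closed_annihilator], this is what makes the summands closed. *)
Lemma splitting_annihilator_m : symplectic_splitting omega Xp Xm ->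
  annihilator omega Xp = Xm.
Proof.
move=> hs; have [_ _ _ _ orth] := hs.
apply/seteqP; split=> [z hz|y my x px]; last exact: orth.
have [x [y [px my zE]]] := splitting_decomp z hs.
suff x0 : x = 0 by rewrite zE x0 add0r.
apply: splitting_null_p => //.
by have := hz x px; rewrite zE omegaDr (orth x y)// addr0.
Qed.

Lemma splitting_annihilator_p : symplectic_splitting omega Xp Xm ->
  annihilator omega Xm = Xp.
Proof.
move=> hs; have [_ _ _ _ orth] := hs.
apply/seteqP; split=> [z hz|x px y my]; last exact/symplectic_antisym/orth.
have [x [y [px my zE]]] := splitting_decomp z hs.
suff y0 : y = 0 by rewrite zE y0 addr0.
apply: splitting_null_m => //.
have := hz y my.
by rewrite zE omegaDr (symplectic_antisym (orth x y px my)) add0r.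
Qed.

(** Given [z = x + y] in the annihilator of [mu], subtract [x + V x], which is
    in [mu]: the remainder [y - V x] is in [Xm] and equals [V x'] for some [x'],
    so pairing it with [x' + V x'] computes its square. *)
Lemma isotropic_graph_lagrangian (V : operator X) (mu : set X) :
    symplectic_splitting omega Xp Xm -> isotropic omega mu ->
    generating_operator Xp Xm mu V -> dom V = Xp -> ran V = Xm ->
  lagrangian omega mu.
Proof.
move=> hs [smu iso] [lV _ muE] domV ranV; split => //.
apply/seteqP; split=> // z hz.
have [[sp sm] _ _ _ orth] := hs.
have [x [y [px my zE]]] := splitting_decomp z hs.
have mx : mu (x + V x) by rewrite muE; exists x => //; rewrite domV.
have mVx : Xm (V x) by rewrite -ranV; exists x => //; rewrite domV.
suff : y - V x = 0.
  by move/eqP; rewrite subr_eq0 => /eqP yE; rewrite zE yE.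
have mw : Xm (y - V x) by exact: subspaceB.
apply: splitting_null_m => //.
have [x' Dx' e] : ran V (y - V x) by rewrite ranV.
have px' : Xp x' by rewrite -domV.
have mx' : mu (x' + V x') by rewrite muE; exists x'.
have : omega (x' + V x') (z - (x + V x)) = 0.
  by rewrite omegaBr hz// (iso _ mx)// subrr.
by rewrite zE opprD addrACA subrr add0r omegaDl e orth// add0r.
Qed.

End Symplectic.

(** * The Fredholm pair and the operator *)

Theorem proposition2 (R : realType) (X : completeNormedModType R[i])
  (omega : {hermitian X for true & @Num.conj R[i]})
  (Xp Xm lambda mu : set X) (U V : operator X)
  (homega : symplectic omega)
  (hsplit : symplectic_splitting omega Xp Xm)
  (hlambda : isotropic omega lambda)
  (hmu : isotropic omega mu)
  (hU : generating_operator Xp Xm lambda U)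
  (hV : generating_operator Xp Xm mu V)
  (hVdom : dom V = Xp)
  (hVran : ran V = Xm)
  (hVbounded : bounded_operator V)
  (hVinv_bounded : bounded_operator (op_inv V)) :
  let UVinv_sub_I := op_sub (op_comp U (op_inv V)) (op_id Xm) in
  let U_sub_V := op_sub U V in
  [/\ (* (a) *)
      lagrangian omega mu,
      (* (b) *)
      fredholm_pair lambda mu <->
        fredholm_operator Xm Xm UVinv_sub_I /\ dom UVinv_sub_I = V @` dom U,
      (* (c) *)
      fredholm_pair lambda mu ->
        [/\ fredholm_operator Xp Xm U_sub_V, dom U_sub_V = dom U &
            pair_index lambda mu = op_index Xm UVinv_sub_I] &
      (* (d) *)
      closed lambda ->
        closed_operator Xp Xm U_sub_V /\ closed_operator Xm Xm UVinv_sub_I].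
Proof.
move=> T D.
have lagr := isotropic_graph_lagrangian hsplit hmu hV hVdom hVran.
have [[sp sm] [sumX cap0] _ _ _] := hsplit.
have cp : closed Xp.
  by rewrite -(splitting_annihilator_p hsplit); exact: closed_annihilator.
have cm : closed Xm.
  by rewrite -(splitting_annihilator_m hsplit); exact: closed_annihilator.
have [P [PX XP cP]] := exists_projection sp sm cp cm sumX cap0.
have [lU _ lambdaE] := hU; have [lV injV muE] := hV.
have [|W [WE cW]] := bounded_operator_extend lV hVbounded _ cP.
  by move=> x; rewrite hVdom.
pose P' : {linear X -> X} := (idfun \- P).
have [||W' [W'E cW']] :=
    @bounded_operator_extend _ _ _ _ _ P' (op_inv_linear injV lV) hVinv_bounded.
- by move=> x; rewrite /= hVran.
- by move=> x; apply: cvgB; [exact: cvg_id|exact: cP].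
have W'E' x : W' x = op_inv V (x - P x) by rewrite W'E.
subst lambda mu.
have fredT := fredholm_pair_comp sp sm cap0 PX XP lU lV injV hVdom hVran
  cP WE cW W'E' cW'.
have domD := dom_subE lU hVdom.
split=> //.
- split=> [/fredT fT|[fT _]]; last exact/fredT.
  split=> //; exact: (dom_compE sp sm cap0 PX XP lU injV hVdom hVran W'E').
- move=> fred; split=> //.
    exact: (fredholm_pair_sub sp sm cap0 PX XP lU lV hVdom hVran cP WE cW).
  exact: (pair_index_comp sp sm cap0 PX XP lU lV injV hVdom hVran WE W'E').
- move=> cl; split.
    exact: (closed_graph_sub sp sm cap0 PX XP lU lV hVdom hVran WE cW).
  exact: (closed_graph_comp_sub sp sm cap0 PX XP lU injV hVdom hVran W'E' cW').
Qed.
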